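(* Let $U$ be an open neighborhood of $0$ in $\mathbb{H}\cong\mathbb{C}^2$ and let $f=f_1+f_2\mathbf{j}$ be a quaternionic function on $U$, possibly defined only almost everywhere on $U$, belonging to the class of functions described in the context, with complex-valued components $f_1,f_2$. Then the following conditions are equivalent: (i) the function $f$ and its right inverse $f^{-1}$ are hyperholomorphic, when they are defined; (ii) we have the equations $$(\overline f_1-f_1)\frac{\partial\overline f_1}{\partial z_1}-\overline f_2\frac{\partial f_2}{\partial z_1}-f_2\frac{\partial\overline f_1}{\partial\overline z_2}=0,$$ $$\overline f_2\frac{\partial f_1}{\partial z_1}+\frac{\partial\overline f_2}{\partial z_1}(\overline f_1-f_1)-f_2\frac{\partial\overline f_2}{\partial\overline z_2}=0.$$
   Context: A quaternion $q\in\mathbb{H}$ is written $q=z_1+z_2\mathbf{j}$ with $z_1,z_2\in\mathbb{C}$, where $\mathbf{j}^2=-1$ and $z\mathbf{j}=\mathbf{j}\overline z$ for $z\in\mathbb{C}$; this identifies $\mathbb{H}$ with $\mathbb{C}^2$. The notation $|q|$ means $|q|=z_1\overline z_1+z_2\overline z_2$ (the square of the Euclidean norm). The quaternionic conjugate is $\overline q=\overline z_1-z_2\mathbf{j}$, and the (right) inverse of $q\neq0$ is $q^{-1}=|q|^{-1}\overline q$. A $C^\infty$ function $f$ with values in $\mathbb{H}$ is written $f=f_1+f_2\mathbf{j}$ with $C^\infty$ complex-valued components $f_1,f_2$; $Z(f_k)$ denotes the zero set of $f_k$, and $\overline f_1,\overline f_2$ denote the complex conjugates of the components. The class of functions considered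 consists of: (a) the quaternionic functions $f$ on $U$ such that, when $f_1$ and $f_2$ are not holomorphic, the set $Z(f_1)\cap Z(f_2)$ is discrete in $U$, and such that, for every $q\in Z(f_1)\cap Z(f_2)$ and $i=1,2$, the supremum $m_i$ of the orders $\alpha_i$ for which the jet of order $\alpha_i$ of $f_i$ at $q$ vanishes is finite; (b) also the quaternionic functions defined almost everywhere on $U$, i.e. outside a locally finite set of $C^\infty$ hypersurfaces, namely $Z(f_1)$, $Z(f_2)$. The (right) inverse of $f$ is the function $q\mapsto f(q)^{-1}$, defined almost everywhere on $U$; thus $f^{-1}=|f|^{-1}(\overline f_1-f_2\mathbf{j})$ with $|f|=f_1\overline f_1+f_2\overline f_2$. The modified Cauchy-Fueter operator is $$\mathcal{D}f=\frac12\Big(\frac{\partial}{\partial\overline z_1}+\mathbf{j}\frac{\partial}{\partial\overline z_2}\Big)f,$$ where $\frac{\partial f}{\partial\overline z_k}=\frac{\partial f_1}{\partial\overline z_k}+\frac{\partial f_2}{\partial\overline z_k}\mathbf{j}$ (usual Wirtinger derivatives of the components). A $C^\infty$ function $f$ on an open set is hyperholomorphic if $\mathcal{D}f=0$ there; equivalently $$\frac{\partial f_1}{\partial\overline z_1}-\frac{\partial\overline f_2}{\partial z_2}=0,\qquad \frac{\partial f_1}{\partial\overline z_2}+\frac{\partial\overline f_2}{\partial z_1}=0.$$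
   Formalization: Condition (ii) is supplemented by the requirement that f itself is hyperholomorphic where defined; without it (ii) does not imply (i), e.g. f = z̄₂ + j satisfies both equations of (ii) but is not hyperholomorphic. *)

(* Defs.v *)
From mathcomp Require Import all_boot all_order all_algebra.
From mathcomp Require Import all_classical all_reals all_analysis.
From mathcomp.real_closed Require Export complex.

Set Implicit Arguments.
Unset Strict Implicit.
Unset Printing Implicit Defensive.

Import Order.TTheory GRing.Theory Num.Theory.
Import numFieldNormedType.Exports.

Local Open Scope classical_set_scope.
Local Open Scope ring_scope.
Local Open Scope complex_scope.

(* Points of H = C^2 are given by their real coordinates (x1, y1, x2, y2),
   where z1 = x1 + i y1 and z2 = x2 + i y2; this is where the topology and the
   derivatives of the library live.  Values in H are elements of [quat]. *)
Definition Hpoint (R : realType) := 'rV[R]_4.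

Section PartialDerivatives.
Variable R : realType.
Implicit Types (W : set (Hpoint R)) (g : Hpoint R -> R) (h : Hpoint R -> R[i]).

Definition basis_vec (k : 'I_4) : Hpoint R := delta_mx 0 k.

Definition pd (k : 'I_4) g : Hpoint R -> R := fun p => 'D_(basis_vec k) g p.

Definition iter_pd (s : seq 'I_4) g : Hpoint R -> R := foldr pd g s.

Definition smooth_on W g : Prop :=
  forall (s : seq 'I_4) (p : Hpoint R), W p ->
    {for p, continuous (iter_pd s g)} /\
    forall k, derivable (iter_pd s g) p (basis_vec k).

Definition smooth_onC W h : Prop :=
  smooth_on W (fun p => complex.Re (h p)) /\
  smooth_on W (fun p => complex.Im (h p)).

(* The jet of order [a] of [h] at [p] vanishes. *)
Definition jet_vanishes (a : nat) h (p : Hpoint R) : Prop :=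
  forall s : seq 'I_4, (size s <= a)%N ->
    iter_pd s (fun q => complex.Re (h q)) p = 0 /\
    iter_pd s (fun q => complex.Im (h q)) p = 0.

Definition pdC (k : 'I_4) h : Hpoint R -> R[i] := fun p =>
  pd k (fun q => complex.Re (h q)) p +i* pd k (fun q => complex.Im (h q)) p.

End PartialDerivatives.

Section Wirtinger.
Variable R : realType.
Implicit Type h : Hpoint R -> R[i].

(* The coordinates x1, y1, x2, y2 have indices 0, 1, 2, 3. *)
Definition ix1 : 'I_4 := @Ordinal 4 0 isT.
Definition iy1 : 'I_4 := @Ordinal 4 1 isT.
Definition ix2 : 'I_4 := @Ordinal 4 2 isT.
Definition iy2 : 'I_4 := @Ordinal 4 3 isT.

Definition dz1 h : Hpoint R -> R[i] :=
  fun p => 2^-1 * (pdC ix1 h p - 'i%C * pdC iy1 h p).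
Definition dz2 h : Hpoint R -> R[i] :=
  fun p => 2^-1 * (pdC ix2 h p - 'i%C * pdC iy2 h p).
Definition dzbar1 h : Hpoint R -> R[i] :=
  fun p => 2^-1 * (pdC ix1 h p + 'i%C * pdC iy1 h p).
Definition dzbar2 h : Hpoint R -> R[i] :=
  fun p => 2^-1 * (pdC ix2 h p + 'i%C * pdC iy2 h p).

Definition holomorphic_on (W : set (Hpoint R)) h : Prop :=
  smooth_onC W h /\ forall p, W p -> dzbar1 h p = 0 /\ dzbar2 h p = 0.

End Wirtinger.

(* The pair (z1, z2) stands for z1 + z2 j. *)
Definition quat (R : realType) := (R[i] * R[i])%type.

Section Quaternions.
Variable R : realType.
Implicit Types (q r : quat R) (f : Hpoint R -> quat R) (W : set (Hpoint R)).

(* From j^2 = -1 and z j = j z^*. *)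
Definition qmul q r : quat R :=
  (q.1 * r.1 - q.2 * (r.2)^*%C, q.1 * r.2 + q.2 * (r.1)^*%C).

Definition qj : quat R := (0, 1).

Definition qscale (c : R[i]) q : quat R := (c * q.1, c * q.2).

Definition qconj q : quat R := ((q.1)^*%C, - q.2).

(* The square of the Euclidean norm, as a complex number. *)
Definition qnorm q : R[i] := q.1 * (q.1)^*%C + q.2 * (q.2)^*%C.

Definition qinv q : quat R := qscale (qnorm q)^-1 (qconj q).

Definition comp1 f : Hpoint R -> R[i] := fun p => (f p).1.
Definition comp2 f : Hpoint R -> R[i] := fun p => (f p).2.

Definition right_inv f : Hpoint R -> quat R := fun p => qinv (f p).

Definition qdzbar1 f : Hpoint R -> quat R :=
  fun p => (dzbar1 (comp1 f) p, dzbar1 (comp2 f) p).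
Definition qdzbar2 f : Hpoint R -> quat R :=
  fun p => (dzbar2 (comp1 f) p, dzbar2 (comp2 f) p).

Definition cauchy_fueter f : Hpoint R -> quat R :=
  fun p => qscale 2^-1 (qdzbar1 f p + qmul qj (qdzbar2 f p)).

Definition smooth_onH W f : Prop :=
  smooth_onC W (comp1 f) /\ smooth_onC W (comp2 f).

Definition hyperholomorphic_on W f : Prop :=
  smooth_onH W f /\ forall p, W p -> cauchy_fueter f p = 0.

End Quaternions.

Section FunctionClass.
Variable R : realType.
Implicit Types (U W M : set (Hpoint R)) (h : Hpoint R -> R[i])
  (f : Hpoint R -> quat R).

Definition zeros U h : set (Hpoint R) := [set p | U p /\ h p = 0].

Definition discrete_in U (Z : set (Hpoint R)) : Prop :=
  Z `<=` U /\ forall p, Z p -> isolated Z p.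

(* A C^oo hypersurface of [U]: relatively closed, and locally the zero set of
   a C^oo real function with nonzero differential. *)
Definition hypersurface U M : Prop :=
  [/\ M `<=` U, closure M `&` U `<=` M &
    forall p, M p -> exists (N : set (Hpoint R)) (rho : Hpoint R -> R),
      [/\ open N, N p, smooth_on N rho,
          exists k, pd k rho p != 0 &
          forall q, N q -> (M q <-> rho q = 0)]].

Definition locally_finite_in U (E : set (set (Hpoint R))) : Prop :=
  forall p, U p -> exists2 N : set (Hpoint R),
    nbhs p N & finite_set [set M | E M /\ M `&` N !=set0].

Definition class_a U f : Prop :=
  [/\ smooth_onH U f,
      ~ holomorphic_on U (comp1 f) -> ~ holomorphic_on U (comp2 f) ->
        discrete_in U (zeros U (comp1 f) `&` zeros U (comp2 f)) &
      forall p, zeros U (comp1 f) p -> zeros U (comp2 f) p ->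
        (exists m : nat, forall a, jet_vanishes a (comp1 f) p -> (a <= m)%N) /\
        (exists m : nat, forall a, jet_vanishes a (comp2 f) p -> (a <= m)%N)].

(* [W] is the domain of definition of [f], which is at least the complement in
   [U] of the hypersurfaces that make up the zero sets of the components.  As
   with [0^-1 = 0], some component is understood to take the value 0 at the
   points of [U] where [f] is not defined; nothing else is assumed there. *)
Definition class_b U W f : Prop :=
  [/\ open W, W `<=` U, smooth_onH W f,
      U `\` (zeros U (comp1 f) `|` zeros U (comp2 f)) `<=` W &
      exists E : set (set (Hpoint R)),
        [/\ forall M, E M -> hypersurface U M, locally_finite_in U E &
            zeros U (comp1 f) `|` zeros U (comp2 f) = \bigcup_(M in E) M]].

Definition in_class U W f : Prop := (W = U /\ class_a U f) \/ class_b U W f.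

(* The domain of definition of [right_inv f], for [f] defined on [W]. *)
Definition inv_domain W f : set (Hpoint R) := [set p | W p /\ f p <> 0].

End FunctionClass.

(* Main.v *)
Require Import Defs.
From mathcomp Require Import all_boot all_order all_algebra.
From mathcomp Require Import all_classical all_reals all_analysis.
From mathcomp.real_closed Require Import complex.
From mathcomp Require Import ring.

Import Order.TTheory GRing.Theory Num.Theory.
Import numFieldNormedType.Exports.

Local Open Scope classical_set_scope.
Local Open Scope ring_scope.
Local Open Scope complex_scope.

(* Write N = |f|, and let E1, E2 be the left-hand sides of the two equations
   of (ii), with conjugates A, B.  Where f is hyperholomorphic and nonzero, the
   quotient rule shows that D(f^-1) is, up to the factor N^-2 / 2, the pair
   (f1^* A + f2^* B, f1 B - f2 A).  The linear map (A, B) |-> D(f^-1) has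
   determinant a multiple of f1 f1^* + f2 f2^* = N <> 0, so D(f^-1) vanishes
   exactly when E1 = E2 = 0.  At a zero of f both equations hold trivially,
   since each of their terms contains f1, f2 or a conjugate as a factor. *)

(** * Calculus of smooth real functions: sums, products and inverses *)

Section RealSmoothness.
Set Implicit Arguments.
Unset Strict Implicit.
Context {R : realType}.
Implicit Types (W V : set (Hpoint R)) (g h : Hpoint R -> R) (k : 'I_4)
  (p : Hpoint R).

Lemma near_open W p (P : Hpoint R -> Prop) :
  open W -> W p -> (forall q, W q -> P q) -> \forall q \near p, P q.
Proof.
move=> oW Wp WP; apply: filterS WP _.
by rewrite nbhsE /=; exists W.
Qed.

Lemma near_eq_continuous (S T : topologicalType) (u v : S -> T) (x : S) :
  (\forall y \near x, u y = v y) ->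
  {for x, continuous u} -> {for x, continuous v}.
Proof.
move=> uv; rewrite /prop_for /continuous_at (nbhs_singleton uv).
apply: cvg_trans; apply: near_eq_cvg.
by apply: filterS uv => y ->.
Qed.

Lemma pdD k g h p :
  derivable g p (basis_vec R k) -> derivable h p (basis_vec R k) ->
  pd k (fun q => g q + h q) p = pd k g p + pd k h p.
Proof. exact: deriveD. Qed.

Lemma pdB k g h p :
  derivable g p (basis_vec R k) -> derivable h p (basis_vec R k) ->
  pd k (fun q => g q - h q) p = pd k g p - pd k h p.
Proof. exact: deriveB. Qed.

Lemma pdN k g p : derivable g p (basis_vec R k) ->
  pd k (fun q => - g q) p = - pd k g p.
Proof. exact: deriveN. Qed.

Lemma pdM k g h p :
  derivable g p (basis_vec R k) -> derivable h p (basis_vec R k) ->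
  pd k (fun q => g q * h q) p = g p * pd k h p + h p * pd k g p.
Proof. exact: deriveM. Qed.

(** The square is kept as a product of two inverses, so that [smooth_uptoM] applies to this
    expression in [smooth_uptoV]. *)
Lemma pdV k g p : g p != 0 -> derivable g p (basis_vec R k) ->
  pd k (fun q => (g q)^-1) p = - ((g p)^-1 * (g p)^-1) * pd k g p.
Proof.
by move=> g0 dg; rewrite /pd deriveV// -mulr_algl -expr2 exprVn scaler1.
Qed.

(* Unlike [iter_pd], this recursion peels off the innermost derivative, so that
   the product and inverse rules can be proved by induction on the order. *)
Fixpoint smooth_upto n W g : Prop :=
  (forall p, W p -> {for p, continuous g}) /\
  if n is m.+1 then
    forall k, (forall p, W p -> derivable g p (basis_vec R k)) /\
      smooth_upto m W (pd k g)
  else True.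

Lemma smooth_uptoW n W g : smooth_upto n.+1 W g -> smooth_upto n W g.
Proof.
elim: n g => [|n IH] g [cg dg]; first by split.
by split=> // k; have [dk /IH] := dg k.
Qed.

Lemma iter_pd_rcons s k g : iter_pd (rcons s k) g = iter_pd s (pd k g).
Proof. by rewrite /iter_pd foldr_rcons. Qed.

(** Both sides speak of the same iterated derivatives. Peeling the last index of [s], the derivative
    that [iter_pd] applies first, matches the recursion of [smooth_upto]. *)
Lemma smooth_onP W g : smooth_on W g <-> forall n, smooth_upto n W g.
Proof.
split=> [sg n|sg s].
  elim: n g sg => [|n IH] g sg.
    by split=> // p Wp; have [] := sg [::] p Wp.
  split=> [p Wp|k]; first by have [] := sg [::] p Wp.
  split=> [p Wp|]; first by have [_] := sg [::] p Wp.
  by apply: IH => s p Wp; rewrite -iter_pd_rcons; exact: sg.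
elim/last_ind: s g sg => [|s k IH] g sg p Wp.
  have [cg dg] := sg 1%N; split; first exact: cg.
  by move=> k; exact: (dg k).1.
rewrite iter_pd_rcons; apply: IH => // n.
by have [_ /(_ k) []] := sg n.+1.
Qed.

Lemma smooth_on_sub W V g : V `<=` W -> smooth_on W g -> smooth_on V g.
Proof. by move=> VW sg s p /VW; exact: sg. Qed.

(** Since [W] is open, equality on [W] is equality near each of its points and passes to
    derivatives. This lets a derivative be replaced by a formula that is valid on [W] only. *)
Lemma eq_smooth_upto n W g h : open W -> (forall p, W p -> g p = h p) ->
  smooth_upto n W g -> smooth_upto n W h.
Proof.
move=> oW; elim: n g h => [|n IH] g h gh [cg dg].
  split=> // p Wp; apply: near_eq_continuous (cg p Wp).
  exact: near_open oW Wp gh.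
split=> [p Wp|k].
  apply: near_eq_continuous (cg p Wp).
  exact: near_open oW Wp gh.
have [dk sk] := dg k; split=> [p Wp|].
  by apply: (near_eq_derivable (f := g)); [exact: near_open oW Wp gh|exact: dk].
apply: IH sk => p Wp; apply: near_eq_derive; exact: near_open oW Wp gh.
Qed.

Lemma smooth_uptoD n W g h : open W ->
  smooth_upto n W g -> smooth_upto n W h ->
  smooth_upto n W (fun q => g q + h q).
Proof.
move=> oW; elim: n g h => [|n IH] g h [cg dg] [ch dh].
  by split=> // p Wp; apply: continuousD; [exact: cg|exact: ch].
split=> [p Wp|k]; first by apply: continuousD; [exact: cg|exact: ch].
have [dgk sgk] := dg k; have [dhk shk] := dh k.
split=> [p Wp|]; first by apply: derivableD; [exact: dgk|exact: dhk].
apply: eq_smooth_upto (IH _ _ sgk shk) => // p Wp.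
by rewrite pdD; [|exact: dgk|exact: dhk].
Qed.

Lemma smooth_uptoN n W g : open W ->
  smooth_upto n W g -> smooth_upto n W (fun q => - g q).
Proof.
move=> oW; elim: n g => [|n IH] g [cg dg].
  by split=> // p Wp; apply: continuousN; exact: cg.
split=> [p Wp|k]; first by apply: continuousN; exact: cg.
have [dgk sgk] := dg k.
split=> [p Wp|]; first by apply: derivableN; exact: dgk.
by apply: eq_smooth_upto (IH _ sgk) => // p Wp; rewrite pdN//; exact: dgk.
Qed.

Lemma smooth_uptoM n W g h : open W ->
  smooth_upto n W g -> smooth_upto n W h ->
  smooth_upto n W (fun q => g q * h q).
Proof.
move=> oW; elim: n g h => [|n IH] g h sg sh.
  have [cg _] := sg; have [ch _] := sh.
  by split=> // p Wp; apply: continuousM; [exact: cg|exact: ch].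
have [cg dg] := sg; have [ch dh] := sh.
split=> [p Wp|k]; first by apply: continuousM; [exact: cg|exact: ch].
have [dgk sgk] := dg k; have [dhk shk] := dh k.
split=> [p Wp|]; first by apply: derivableM; [exact: dgk|exact: dhk].
(* The Leibniz formula also contains the undifferentiated factors, which must be brought down to
   order [n] for the induction hypothesis. *)
move/smooth_uptoW in sg; move/smooth_uptoW in sh.
apply: eq_smooth_upto (smooth_uptoD oW (IH _ _ sg shk) (IH _ _ sh sgk)) => //.
by move=> p Wp; rewrite pdM; [|exact: dgk|exact: dhk].
Qed.

(** The derivative of the inverse involves only the inverse itself, smooth to order [n] by
    induction, and [pd k g]. *)
Lemma smooth_uptoV n W g : open W -> (forall p, W p -> g p != 0) ->
  smooth_upto n W g -> smooth_upto n W (fun q => (g q)^-1).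
Proof.
move=> oW g0; elim: n => [|n IH] sg.
  by have [cg _] := sg; split=> // p Wp; apply: continuousV; [exact: g0|exact: cg].
have [cg dg] := sg.
split=> [p Wp|k]; first by apply: continuousV; [exact: g0|exact: cg].
have [dgk sgk] := dg k.
split=> [p Wp|]; first by apply: derivableV; [exact: g0|exact: dgk].
have /IH sV := smooth_uptoW sg.
apply: eq_smooth_upto
  (smooth_uptoM oW (smooth_uptoN oW (smooth_uptoM oW sV sV)) sgk) => // p Wp.
by rewrite pdV; [|exact: g0|exact: dgk].
Qed.

Lemma smooth_onD W g h : open W -> smooth_on W g -> smooth_on W h ->
  smooth_on W (fun q => g q + h q).
Proof.
move=> oW /smooth_onP sg /smooth_onP sh.
by apply/smooth_onP => n; exact: smooth_uptoD.
Qed.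

Lemma smooth_onN W g : open W -> smooth_on W g ->
  smooth_on W (fun q => - g q).
Proof.
by move=> oW /smooth_onP sg; apply/smooth_onP => n; exact: smooth_uptoN.
Qed.

Lemma smooth_onM W g h : open W -> smooth_on W g -> smooth_on W h ->
  smooth_on W (fun q => g q * h q).
Proof.
move=> oW /smooth_onP sg /smooth_onP sh.
by apply/smooth_onP => n; exact: smooth_uptoM.
Qed.

Lemma smooth_onV W g : open W -> (forall p, W p -> g p != 0) ->
  smooth_on W g -> smooth_on W (fun q => (g q)^-1).
Proof.
by move=> oW g0 /smooth_onP sg; apply/smooth_onP => n; exact: smooth_uptoV.
Qed.

End RealSmoothness.

(** * Complex functions via real and imaginary parts, and Wirtinger calculus *)

Section ComplexSmoothness.
Set Implicit Arguments.
Unset Strict Implicit.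
Context {R : realType}.
Implicit Types (W V : set (Hpoint R)) (g h : Hpoint R -> R[i]) (k : 'I_4)
  (p : Hpoint R) (z w : R[i]).

Lemma ReD z w : complex.Re (z + w) = complex.Re z + complex.Re w.
Proof. by case: z w => [? ?] [? ?]. Qed.

Lemma ImD z w : complex.Im (z + w) = complex.Im z + complex.Im w.
Proof. by case: z w => [? ?] [? ?]. Qed.

Lemma ReN z : complex.Re (- z) = - complex.Re z.
Proof. by case: z. Qed.

Lemma ImN z : complex.Im (- z) = - complex.Im z.
Proof. by case: z. Qed.

Lemma ReM z w : complex.Re (z * w) =
  complex.Re z * complex.Re w - complex.Im z * complex.Im w.
Proof. by case: z w => [? ?] [? ?]. Qed.

Lemma ImM z w : complex.Im (z * w) =
  complex.Re z * complex.Im w + complex.Im z * complex.Re w.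
Proof. by case: z w => [? ?] [? ?]. Qed.

Lemma Re_conj z : complex.Re z^*%C = complex.Re z.
Proof. by case: z. Qed.

Lemma Im_conj z : complex.Im z^*%C = - complex.Im z.
Proof. by case: z. Qed.

Lemma conjcD z w : (z + w)^*%C = z^*%C + w^*%C.
Proof. exact: rmorphD. Qed.

Lemma conjcN z : (- z)^*%C = - z^*%C.
Proof. exact: rmorphN. Qed.

Lemma conjcM z w : (z * w)^*%C = z^*%C * w^*%C.
Proof. exact: rmorphM. Qed.

(** The squared modulus as a real number: the denominator of the real and imaginary parts of an
    inverse. *)
Definition sqnorm z : R := complex.Re z * complex.Re z + complex.Im z * complex.Im z.

Lemma sqnorm_eq0 z : (sqnorm z == 0) = (z == 0).
Proof.
case: z => a b; rewrite /sqnorm -!expr2 paddr_eq0 ?sqr_ge0//.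
by rewrite !sqrf_eq0 eq_complex.
Qed.

Lemma ReV z : complex.Re z^-1 = complex.Re z * (sqnorm z)^-1.
Proof. by case: z. Qed.

Lemma ImV z : complex.Im z^-1 = - (complex.Im z * (sqnorm z)^-1).
Proof. by case: z. Qed.

Lemma smooth_onC_sub W V h : V `<=` W -> smooth_onC W h -> smooth_onC V h.
Proof. by move=> VW [sr si]; split; exact: smooth_on_sub VW _. Qed.

Lemma smooth_onC_conj W h : open W -> smooth_onC W h ->
  smooth_onC W (fun q => (h q)^*%C).
Proof.
move=> oW [sr si]; split.
  by under eq_fun do rewrite Re_conj.
by under eq_fun do rewrite Im_conj; exact: smooth_onN.
Qed.

Lemma smooth_onCN W h : open W -> smooth_onC W h ->
  smooth_onC W (fun q => - h q).
Proof.
move=> oW [sr si]; split.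
  by under eq_fun do rewrite ReN; exact: smooth_onN.
by under eq_fun do rewrite ImN; exact: smooth_onN.
Qed.

Lemma smooth_onCD W g h : open W -> smooth_onC W g -> smooth_onC W h ->
  smooth_onC W (fun q => g q + h q).
Proof.
move=> oW [gr gi] [hr hi]; split.
  by under eq_fun do rewrite ReD; exact: smooth_onD.
by under eq_fun do rewrite ImD; exact: smooth_onD.
Qed.

Lemma smooth_onCM W g h : open W -> smooth_onC W g -> smooth_onC W h ->
  smooth_onC W (fun q => g q * h q).
Proof.
move=> oW [gr gi] [hr hi]; split.
  under eq_fun do rewrite ReM.
  exact: smooth_onD oW (smooth_onM oW gr hr)
    (smooth_onN oW (smooth_onM oW gi hi)).
under eq_fun do rewrite ImM.
exact: smooth_onD oW (smooth_onM oW gr hi) (smooth_onM oW gi hr).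
Qed.

Lemma smooth_onCV W h : open W -> (forall p, W p -> h p != 0) ->
  smooth_onC W h -> smooth_onC W (fun q => (h q)^-1).
Proof.
move=> oW h0 [hr hi].
have sV : smooth_on W (fun q => (sqnorm (h q))^-1).
  apply: smooth_onV oW _ (smooth_onD oW (smooth_onM oW hr hr)
    (smooth_onM oW hi hi)) => p Wp.
  by rewrite sqnorm_eq0 h0.
split.
  by under eq_fun do rewrite ReV; exact: smooth_onM oW hr sV.
by under eq_fun do rewrite ImV; exact: smooth_onN oW (smooth_onM oW hi sV).
Qed.

Lemma smooth_on_derivable W (u : Hpoint R -> R) k p :
  smooth_on W u -> W p -> derivable u p (basis_vec R k).
Proof. by move=> su Wp; have [_] := su [::] p Wp. Qed.

(** Common form of the Wirtinger operators, so that each rule is proved once: for the real and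
    imaginary coordinates [i], [j] of a variable, [c = - 'i] differentiates in that variable and
    [c = 'i] in its conjugate. *)
Definition wirtinger (i j : 'I_4) (c : R[i]) h : Hpoint R -> R[i] :=
  fun p => 2^-1 * (pdC i h p + c * pdC j h p).

Lemma near_eq_pdC k g h p : (\forall q \near p, g q = h q) ->
  pdC k g p = pdC k h p.
Proof.
by move=> gh; congr (_ +i* _); apply: near_eq_derive; apply: filterS gh => q ->.
Qed.

Section Rules.
Variables (W : set (Hpoint R)) (p : Hpoint R) (Wp : W p).

Lemma pdC_conj k h : smooth_onC W h ->
  pdC k (fun q => (h q)^*%C) p = (pdC k h p)^*%C.
Proof.
move=> [hr hi]; rewrite /pdC.
under [X in pd k X p +i* _]eq_fun do rewrite Re_conj.
under [X in _ +i* pd k X p]eq_fun do rewrite Im_conj.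
by rewrite pdN//; exact: smooth_on_derivable hi Wp.
Qed.

Lemma pdCN k h : smooth_onC W h ->
  pdC k (fun q => - h q) p = - pdC k h p.
Proof.
move=> [hr hi]; rewrite /pdC.
under [X in pd k X p +i* _]eq_fun do rewrite ReN.
under [X in _ +i* pd k X p]eq_fun do rewrite ImN.
by rewrite !pdN//; exact: smooth_on_derivable Wp.
Qed.

Lemma pdCD k g h : smooth_onC W g -> smooth_onC W h ->
  pdC k (fun q => g q + h q) p = pdC k g p + pdC k h p.
Proof.
move=> [gr gi] [hr hi]; rewrite /pdC.
under [X in pd k X p +i* _]eq_fun do rewrite ReD.
under [X in _ +i* pd k X p]eq_fun do rewrite ImD.
by rewrite !pdD//; exact: smooth_on_derivable Wp.
Qed.

Lemma pdCM k g h : smooth_onC W g -> smooth_onC W h ->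
  pdC k (fun q => g q * h q) p = g p * pdC k h p + h p * pdC k g p.
Proof.
move=> [gr gi] [hr hi]; rewrite /pdC.
under [X in pd k X p +i* _]eq_fun do rewrite ReM.
under [X in _ +i* pd k X p]eq_fun do rewrite ImM.
have dgr := smooth_on_derivable (k := k) gr Wp; have dgi := smooth_on_derivable (k := k) gi Wp.
have dhr := smooth_on_derivable (k := k) hr Wp; have dhi := smooth_on_derivable (k := k) hi Wp.
rewrite (pdB (derivableM dgr dhr) (derivableM dgi dhi)).
rewrite (pdD (derivableM dgr dhi) (derivableM dgi dhr)).
rewrite (pdM dgr dhr) (pdM dgi dhi) (pdM dgr dhi) (pdM dgi dhr).
by apply/eqP; rewrite eq_complex !ReD !ImD !ReM !ImM /=; apply/andP; split;
  apply/eqP; ring.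
Qed.

Lemma wirtingerN i j c h : smooth_onC W h ->
  wirtinger i j c (fun q => - h q) p = - wirtinger i j c h p.
Proof. by move=> sh; rewrite /wirtinger !pdCN//; ring. Qed.

Lemma wirtingerD i j c g h : smooth_onC W g -> smooth_onC W h ->
  wirtinger i j c (fun q => g q + h q) p =
  wirtinger i j c g p + wirtinger i j c h p.
Proof. by move=> sg sh; rewrite /wirtinger !pdCD//; ring. Qed.

Lemma wirtingerM i j c g h : smooth_onC W g -> smooth_onC W h ->
  wirtinger i j c (fun q => g q * h q) p =
  g p * wirtinger i j c h p + h p * wirtinger i j c g p.
Proof. by move=> sg sh; rewrite /wirtinger !pdCM//; ring. Qed.

(** The factor 1/2 is real and conjugation commutes with [pdC], so only [c] gets conjugated; for [c]
    equal to plus or minus ['i] this exchanges the two kinds of Wirtinger derivative. *)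
Lemma wirtinger_conj i j c h : smooth_onC W h ->
  wirtinger i j c (fun q => (h q)^*%C) p = (wirtinger i j c^*%C h p)^*%C.
Proof.
move=> sh; rewrite /wirtinger !pdC_conj//.
by rewrite !conjcM conjcD conjcM conjcK conjc_inv conjc_nat.
Qed.

End Rules.

Lemma near_eq_wirtinger i j c g h p : (\forall q \near p, g q = h q) ->
  wirtinger i j c g p = wirtinger i j c h p.
Proof.
by move=> gh; rewrite /wirtinger (near_eq_pdC i gh) (near_eq_pdC j gh).
Qed.

Lemma dz1E h p : dz1 h p = wirtinger ix1 iy1 (- 'i%C) h p.
Proof. by rewrite /wirtinger mulNr. Qed.

Lemma dzbar1E h p : dzbar1 h p = wirtinger ix1 iy1 'i%C h p.
Proof. by []. Qed.

Lemma dzbar2E h p : dzbar2 h p = wirtinger ix2 iy2 'i%C h p.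
Proof. by []. Qed.

Lemma conjci : ('i%C : R[i])^*%C = - 'i%C.
Proof. by apply/eqP; rewrite eq_complex /= oppr0 !eqxx. Qed.

End ComplexSmoothness.

(** * The right inverse and its Cauchy-Fueter derivative *)

Section RightInverse.
Set Implicit Arguments.
Unset Strict Implicit.
Context {R : realType}.
Implicit Types (W : set (Hpoint R)) (f : Hpoint R -> quat R) (p : Hpoint R).

(** Both summands of [qnorm] are nonnegative, so a zero sum forces each to vanish. *)
Lemma qnorm_eq0 (q : quat R) : (qnorm q == 0) = (q == 0).
Proof.
case: q => z w; rewrite /qnorm /= paddr_eq0 ?mulcJ_ge0//.
by rewrite !mulf_eq0 !conjc_eq0 !orbb.
Qed.

Lemma qscale_eq0 (c : R[i]) (q : quat R) : c != 0 ->
  (qscale c q == 0) = (q == 0).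
Proof.
move=> c0; case: q => z w; rewrite -[LHS]/((c * z == 0) && (c * w == 0)).
by rewrite !mulf_eq0 (negPf c0).
Qed.

(** Left multiplication by [qj] swaps the two components, conjugates both, and negates the new first
    one. *)
Lemma cauchy_fueterE f p : cauchy_fueter f p =
  qscale 2^-1 (dzbar1 (comp1 f) p - (dzbar2 (comp2 f) p)^*%C,
               dzbar1 (comp2 f) p + (dzbar2 (comp1 f) p)^*%C).
Proof.
rewrite /cauchy_fueter /qmul /qdzbar1 /qdzbar2 /=; congr (qscale _ (_, _)) => /=.
  by rewrite mul0r mul1r sub0r.
by rewrite mul0r mul1r add0r.
Qed.

(** The system is solved for the [dzbar1] derivatives, so that it can be used as rewriting rules
    that eliminate them. *)
Lemma cauchy_fueter_eq0 f p : cauchy_fueter f p = 0 <->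
  dzbar1 (comp1 f) p = (dzbar2 (comp2 f) p)^*%C /\
  dzbar1 (comp2 f) p = - (dzbar2 (comp1 f) p)^*%C.
Proof.
rewrite cauchy_fueterE; split.
  move/eqP; rewrite qscale_eq0 ?invr_eq0 ?pnatr_eq0// => /andP[/= + +].
  by rewrite subr_eq0 addr_eq0 => /eqP -> /eqP ->.
by move=> [-> ->]; rewrite subrr addNr /qscale /= mulr0.
Qed.

Lemma smooth_qnorm W f : open W -> smooth_onH W f ->
  smooth_onC W (fun q => qnorm (f q)).
Proof.
move=> oW [s1 s2].
exact: smooth_onCD oW (smooth_onCM oW s1 (smooth_onC_conj oW s1))
  (smooth_onCM oW s2 (smooth_onC_conj oW s2)).
Qed.

(** On [W], [f] is nonzero exactly where the real part of [qnorm] is, and that is an open condition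
    by continuity. *)
Lemma open_inv_domain W f : open W -> smooth_onH W f ->
  open (inv_domain W f).
Proof.
move=> oW sf; rewrite openE => p [Wp fp0].
have [sN _] := smooth_qnorm oW sf; have [cN _] := sN [::] p Wp.
have N0 : complex.Re (qnorm (f p)) != 0.
  have /eqP := fp0; rewrite -qnorm_eq0; apply: contra => /eqP N0.
  rewrite eq_complex N0 eqxx /=.
  (* What remains is that the imaginary part of [qnorm] vanishes identically. *)
  by case: (f p) => -[a b] [c d] /=; apply/eqP; ring.
have nW : \forall q \near p, W q by exact: near_open oW Wp _.
have nN : \forall q \near p, complex.Re (qnorm (f q)) != 0.
  exact: cvgr_neq0 cN N0.
apply: filterS2 nW nN => q Wq Nq; split=> // fq0.
by move: Nq; have /eqP := fq0; rewrite -qnorm_eq0 => /eqP ->; rewrite eqxx.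
Qed.

(* The left-hand sides of the two equations of (ii). *)
Definition inv_obstruction1 f p : R[i] :=
  ((comp1 f p)^*%C - comp1 f p) * dz1 (fun q => (comp1 f q)^*%C) p
  - (comp2 f p)^*%C * dz1 (comp2 f) p
  - comp2 f p * dzbar2 (fun q => (comp1 f q)^*%C) p.

Definition inv_obstruction2 f p : R[i] :=
  (comp2 f p)^*%C * dz1 (comp1 f) p
  + dz1 (fun q => (comp2 f q)^*%C) p * ((comp1 f p)^*%C - comp1 f p)
  - comp2 f p * dzbar2 (fun q => (comp2 f q)^*%C) p.

Lemma comp1_right_inv f p :
  comp1 (right_inv f) p = (qnorm (f p))^-1 * (comp1 f p)^*%C.
Proof. by []. Qed.

Lemma comp2_right_inv f p :
  comp2 (right_inv f) p = (qnorm (f p))^-1 * - comp2 f p.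
Proof. by []. Qed.

Lemma smooth_right_inv W f : open W -> smooth_onH W f ->
  smooth_onH (inv_domain W f) (right_inv f).
Proof.
move=> oW sf; have oV := open_inv_domain oW sf.
have VW : inv_domain W f `<=` W by move=> q [].
have [s1 s2] := sf.
have sV : smooth_onC (inv_domain W f) (fun q => (qnorm (f q))^-1).
  apply: smooth_onCV oV _ (smooth_onC_sub VW (smooth_qnorm oW sf)) => q [_].
  by move/eqP; rewrite qnorm_eq0.
split.
  exact: smooth_onCM oV sV (smooth_onC_conj oV (smooth_onC_sub VW s1)).
exact: smooth_onCM oV sV (smooth_onCN oV (smooth_onC_sub VW s2)).
Qed.

(** Quotient rule obtained by differentiating the product [u q * g q = v q], which avoids computing
    the derivative of an inverse. *)
Lemma wirtinger_divl W (p : Hpoint R) i j c (u v g : Hpoint R -> R[i]) :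
  open W -> W p -> smooth_onC W u -> smooth_onC W g -> u p != 0 ->
  (forall q, W q -> u q * g q = v q) ->
  wirtinger i j c g p =
  (u p)^-1 * (wirtinger i j c v p - g p * wirtinger i j c u p).
Proof.
move=> oW Wp su sg u0 ugv.
have ugv' : \forall q \near p, u q * g q = v q by exact: near_open oW Wp ugv.
rewrite -(near_eq_wirtinger i j c ugv') (wirtingerM Wp)//.
by field.
Qed.

(** Once hyperholomorphy of [f] has eliminated its [dzbar1] derivatives, the claim is an identity of
    rational functions in the values of [f], the remaining derivatives and their conjugates. *)
Lemma cauchy_fueter_right_inv W f p : open W -> hyperholomorphic_on W f ->
  inv_domain W f p ->
  let A := (inv_obstruction1 f p)^*%C in
  let B := (inv_obstruction2 f p)^*%C in
  cauchy_fueter (right_inv f) p =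
  qscale (2^-1 * (qnorm (f p))^-1 ^+ 2)
    ((comp1 f p)^*%C * A + (comp2 f p)^*%C * B, comp1 f p * B - comp2 f p * A).
Proof.
move=> oW [sf hf] Vp A B; have [Wp fp0] := Vp.
have [s1 s2] := sf.
have s1c := smooth_onC_conj oW s1; have s2c := smooth_onC_conj oW s2.
have oV := open_inv_domain oW sf.
have VW : inv_domain W f `<=` W by move=> q [].
have [sg1 sg2] := smooth_right_inv oW sf.
have sN := smooth_onC_sub VW (smooth_qnorm oW sf).
have N0 q : inv_domain W f q -> qnorm (f q) != 0.
  by move=> [_ /eqP]; rewrite qnorm_eq0.
have Eg1 q : inv_domain W f q ->
    qnorm (f q) * comp1 (right_inv f) q = (comp1 f q)^*%C.
  by move=> /N0 ?; rewrite comp1_right_inv mulVKf.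
have Eg2 q : inv_domain W f q ->
    qnorm (f q) * comp2 (right_inv f) q = - comp2 f q.
  by move=> /N0 ?; rewrite comp2_right_inv mulVKf.
(* Conjugates are moved outside the derivatives, so that only derivatives of [comp1 f] and [comp2 f]
   occur. *)
have DN i j c : wirtinger i j c (fun q => qnorm (f q)) p =
    comp1 f p * (wirtinger i j c^*%C (comp1 f) p)^*%C
    + (comp1 f p)^*%C * wirtinger i j c (comp1 f) p
    + (comp2 f p * (wirtinger i j c^*%C (comp2 f) p)^*%C
    + (comp2 f p)^*%C * wirtinger i j c (comp2 f) p).
  rewrite -(wirtinger_conj Wp _ _ _ s1) -(wirtinger_conj Wp _ _ _ s2).
  rewrite -(wirtingerM Wp _ _ _ s1 s1c) -(wirtingerM Wp _ _ _ s2 s2c).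
  by rewrite -(wirtingerD Wp _ _ _ (smooth_onCM oW s1 s1c)
    (smooth_onCM oW s2 s2c)).
have Dg1 i j c := wirtinger_divl i j c oV Vp sN sg1 (N0 _ Vp) Eg1.
have Dg2 i j c := wirtinger_divl i j c oV Vp sN sg2 (N0 _ Vp) Eg2.
(* The two equations for [f] stay in the goal, so that the next rewrites bring them to [wirtinger]
   form as well. *)
have [] := (cauchy_fueter_eq0 f p).1 (hf p Wp).
rewrite cauchy_fueterE {}/A {}/B /inv_obstruction1 /inv_obstruction2.
rewrite !dz1E !dzbar1E !dzbar2E !Dg1 !Dg2 {Dg1 Dg2} !DN {DN}.
rewrite !(wirtingerN Wp _ _ _ s2).
rewrite !(wirtinger_conj Wp _ _ _ s1) !(wirtinger_conj Wp _ _ _ s2).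
rewrite comp1_right_inv comp2_right_inv !(conjcN, conjci) !opprK.
move=> H1 H2.
have NE : qnorm (f p) =
  comp1 f p * (comp1 f p)^*%C + comp2 f p * (comp2 f p)^*%C by [].
have {}N0 := N0 _ Vp.
(* [qnorm] is real, so conjugation fixes it and its inverse. *)
have Nc : (qnorm (f p))^*%C = qnorm (f p).
  by rewrite NE conjcD !conjcM !conjcK [in LHS]mulrC [X in _ + X]mulrC.
rewrite H1 H2 {H1 H2}.
(* Values, the six remaining derivatives and finally all conjugates become independent variables for
   [field], related only by [NE]. *)
move: (qnorm (f p)) (comp1 f p) (comp2 f p) => N F1 F2 in NE N0 Nc *.
move: (wirtinger ix1 iy1 (- 'i%C) (comp1 f) p) => a.
move: (wirtinger ix1 iy1 (- 'i%C) (comp2 f) p) => b.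
move: (wirtinger ix2 iy2 (- 'i%C) (comp1 f) p) => c.
move: (wirtinger ix2 iy2 (- 'i%C) (comp2 f) p) => d.
move: (wirtinger ix2 iy2 'i%C (comp1 f) p) => e.
move: (wirtinger ix2 iy2 'i%C (comp2 f) p) => h.
rewrite !(conjcD, conjcN, conjcM, conjc_inv, conjcK, Nc).
move: (F1^*%C) (F2^*%C) (a^*%C) (b^*%C) (c^*%C) (d^*%C) (e^*%C) (h^*%C) NE
  => F1' F2' a' b' c' d' e' h' NE.
rewrite /qscale/= -!mulrA; congr (_ * _, _ * _);
  by rewrite NE in N0 *; field.
Qed.

Lemma hyperholomorphic_right_inv W f : open W -> hyperholomorphic_on W f ->
  hyperholomorphic_on (inv_domain W f) (right_inv f) <->
  forall p, W p -> inv_obstruction1 f p = 0 /\ inv_obstruction2 f p = 0.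
Proof.
move=> oW hf; have [sf _] := hf; split=> [[_ hg] p Wp|E].
  (* [inv_domain] omits the zeros of [f], so they are treated apart; the derivatives are generalized
     there because only their factors matter. *)
  have [fp0|/eqP fp0] := eqVneq (f p) 0.
    have [F1 F2] : comp1 f p = 0 /\ comp2 f p = 0 by rewrite /comp1 /comp2 fp0.
    rewrite /inv_obstruction1 /inv_obstruction2 F1 F2 conjc0 subrr.
    move: (dz1 _ p) (dz1 _ p) (dz1 _ p) (dz1 _ p) (dzbar2 _ p) (dzbar2 _ p).
    by move=> *; split; ring.
  have Vp : inv_domain W f p by [].
  have := hg p Vp; rewrite (cauchy_fueter_right_inv oW hf Vp) /=.
  have N0 : qnorm (f p) != 0 by rewrite qnorm_eq0; apply/eqP.
  move/eqP; rewrite qscale_eq0; last first.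
    by rewrite mulf_neq0 ?expf_neq0 ?invr_eq0 ?pnatr_eq0.
  move=> /andP[/= /eqP + /eqP].
  have NE : qnorm (f p) =
    comp1 f p * (comp1 f p)^*%C + comp2 f p * (comp2 f p)^*%C by [].
  move: (inv_obstruction1 f p) (inv_obstruction2 f p) => A B.
  move: (qnorm (f p)) (comp1 f p) (comp2 f p) => N F1 F2 in N0 NE * => AB BA.
  (* Cramer's rule for the linear system in the conjugates of [A] and [B], whose determinant is [N]:
     each combination isolates one unknown. *)
  have A0 : N * A^*%C = 0.
    transitivity (F1 * (F1^*%C * A^*%C + F2^*%C * B^*%C)
                  - F2^*%C * (F1 * B^*%C - F2 * A^*%C)).
      by rewrite NE; ring.
    by rewrite AB BA !mulr0 subr0.
  have B0 : N * B^*%C = 0.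
    transitivity (F2 * (F1^*%C * A^*%C + F2^*%C * B^*%C)
                  + F1^*%C * (F1 * B^*%C - F2 * A^*%C)).
      by rewrite NE; ring.
    by rewrite AB BA !mulr0 addr0.
  move/eqP: A0; rewrite mulf_eq0 (negPf N0) conjc_eq0 => /eqP ->.
  by move/eqP: B0; rewrite mulf_eq0 (negPf N0) conjc_eq0 => /eqP ->.
split=> [|p Vp]; first exact: smooth_right_inv.
rewrite (cauchy_fueter_right_inv oW hf Vp) /=.
by have [-> ->] := E p Vp.1; rewrite conjc0 /qscale/= !mulr0 subr0 addr0 mulr0.
Qed.

End RightInverse.

(** Hyperholomorphy of [f] stands on both sides because the two equations alone do not imply it:
    they hold for every real-valued [f1] with [f2 = 0]. *)
Theorem proposition3p1 (R : realType) (U W : set (Hpoint R))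
    (f : Hpoint R -> quat R) :
  open U -> U 0 -> in_class U W f ->
  let f1 := comp1 f in
  let f2 := comp2 f in
  let f1b := fun p => (f1 p)^*%C in
  let f2b := fun p => (f2 p)^*%C in
  (hyperholomorphic_on W f /\ hyperholomorphic_on (inv_domain W f) (right_inv f))
  <->
  (hyperholomorphic_on W f /\
   forall p, W p ->
     (f1b p - f1 p) * dz1 f1b p - f2b p * dz1 f2 p - f2 p * dzbar2 f1b p = 0 /\
     f2b p * dz1 f1 p + dz1 f2b p * (f1b p - f1 p) - f2 p * dzbar2 f2b p = 0).
Proof.
move=> oU _ fW f1 f2 f1b f2b.
have oW : open W by case: fW => [[-> _]|[]].
(* The displayed equations are [inv_obstruction1] and [inv_obstruction2] unfolded. *)
by split=> -[hf E]; split=> //; apply/(hyperholomorphic_right_inv oW hf).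
Qed.
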